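(* Let $Q$ be a medial quandle such that all orbits of $Q$ are latin (as subquandles). Then $Q$ is isomorphic to a direct product of a latin quandle and a projection quandle.
   Context: A quandle is a non-empty set $Q$ with a binary operation such that for all $x,y,z$: $xx=x$; $x(yz)=(xy)(xz)$; and $xu=y$ has a unique solution $u\in Q$. It is medial if $(xy)(uv)=(xu)(yv)$ for all $x,y,u,v\in Q$. The left translation by $a$ is $L_a(x)=ax$; $\mathrm{LMlt}(Q)$ is the permutation group generated by all $L_a$, $a\in Q$. The orbits of $Q$ are the orbits of the action of $\mathrm{LMlt}(Q)$ on $Q$; each orbit is a subquandle of $Q$. A quandle is latin if all right translations $R_a(x)=xa$ are also bijections. A projection quandle is a non-empty set with the operation $ab=b$. *)

(* Defs.v *)
From mathcomp Require Import all_boot.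
From mathcomp Require Import boolp classical_sets.

Set Implicit Arguments.
Unset Strict Implicit.
Unset Printing Implicit Defensive.

Local Open Scope classical_set_scope.

Reserved Notation "x |> y" (at level 40, left associativity).

Record quandle : Type := Quandle {
  qcarrier :> Type;
  qop : qcarrier -> qcarrier -> qcarrier
    where "x |> y" := (qop x y);
  q_nonempty : inhabited qcarrier;
  q_idem : forall x, x |> x = x;
  q_distr : forall x y z, x |> (y |> z) = (x |> y) |> (x |> z);
  q_ldiv : forall x y, exists! u, x |> u = y
}.

Notation "x |> y" := (qop x y).

Definition medial (Q : quandle) : Prop :=
  forall x y u v : Q, (x |> y) |> (u |> v) = (x |> u) |> (y |> v).

Definition left_translation (Q : quandle) (a : Q) : Q -> Q := fun x => a |> x.

Definition right_translation (Q : quandle) (a : Q) : Q -> Q := fun x => x |> a.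

Definition latin (Q : quandle) : Prop :=
  forall a : Q, bijective (right_translation a).

Definition projection (Q : quandle) : Prop := forall a b : Q, a |> b = b.

Inductive LMlt (Q : quandle) : set (Q -> Q) :=
| LMlt_gen a : LMlt (left_translation a)
| LMlt_id : LMlt id
| LMlt_comp f g : LMlt f -> LMlt g -> LMlt (f \o g)
| LMlt_inv f g : LMlt f -> cancel f g -> cancel g f -> LMlt g.

Definition orbit (Q : quandle) (x : Q) : set Q :=
  [set y | exists2 f, LMlt f & f x = y].

Section Subquandle.
Variables (Q : quandle) (S : set Q).
Hypothesis S_nonempty : S !=set0.
Hypothesis S_op : forall x y, S x -> S y -> S (x |> y).
Hypothesis S_ldiv : forall x u, S x -> S (x |> u) -> S u.

Definition sub_op (x y : set_type S) : set_type S :=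
  SigSub (mem_set (S_op (set_valP x) (set_valP y))).

Lemma sub_nonempty : inhabited (set_type S).
Proof. by case: S_nonempty => x Sx; exact: inhabits (SigSub (mem_set Sx)). Qed.

Lemma sub_idem x : sub_op x x = x.
Proof. by apply: val_inj; exact: q_idem. Qed.

Lemma sub_distr x y z :
  sub_op x (sub_op y z) = sub_op (sub_op x y) (sub_op x z).
Proof. by apply: val_inj; exact: q_distr. Qed.

Lemma sub_ldiv x y : exists! u, sub_op x u = y.
Proof.
have [u [xu uniq_u]] := q_ldiv (val x) (val y).
have Su : S u by apply: (S_ldiv (set_valP x)); rewrite xu; exact: set_valP.
exists (SigSub (mem_set Su)); split; first by apply: val_inj.
by move=> v xv; apply: val_inj; apply: uniq_u; rewrite -xv.
Qed.

Definition subquandle : quandle :=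
  Quandle sub_nonempty sub_idem sub_distr sub_ldiv.

End Subquandle.

Section OrbitQuandle.
Variables (Q : quandle) (x : Q).

Lemma orbit_nonempty : orbit x !=set0.
Proof. by exists x; exists id => //; exact: LMlt_id. Qed.

Lemma orbit_op y z : orbit x y -> orbit x z -> orbit x (y |> z).
Proof.
move=> _ [f Lf <-]; exists (left_translation y \o f) => //.
by apply: LMlt_comp => //; exact: LMlt_gen.
Qed.

Lemma orbit_ldiv y u : orbit x y -> orbit x (y |> u) -> orbit x u.
Proof.
move=> _ [f Lf fx].
have [g gP] := choice (q_ldiv y).
have gK : cancel g (left_translation y) by move=> z; case: (gP z).
have Kg : cancel (left_translation y) g.
  by move=> z; case: (gP (y |> z)) => _; exact.
exists (g \o f); last by rewrite /= fx; exact: Kg.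
by apply: LMlt_comp => //; apply: LMlt_inv (LMlt_gen y) Kg gK.
Qed.

Definition orbit_quandle : quandle :=
  subquandle orbit_nonempty orbit_op orbit_ldiv.

End OrbitQuandle.

Section ProductQuandle.
Variables A B : quandle.

Definition prod_op (p q : A * B) : A * B := (p.1 |> q.1, p.2 |> q.2).

Lemma prod_nonempty : inhabited (A * B).
Proof.
by case: (q_nonempty A) => a; case: (q_nonempty B) => b; exact: inhabits (a, b).
Qed.

Lemma prod_idem p : prod_op p p = p.
Proof. by case: p => a b; rewrite /prod_op /= !q_idem. Qed.

Lemma prod_distr p q r :
  prod_op p (prod_op q r) = prod_op (prod_op p q) (prod_op p r).
Proof. by congr pair; exact: q_distr. Qed.

Lemma prod_ldiv p q : exists! u, prod_op p u = q.
Proof.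
have [a [pa uniq_a]] := q_ldiv p.1 q.1.
have [b [pb uniq_b]] := q_ldiv p.2 q.2.
exists (a, b); split; first by case: q pa pb {uniq_a uniq_b} => ? ? /= <- <-.
by move=> [a' b'] pu; congr pair; [apply: uniq_a|apply: uniq_b]; rewrite -pu.
Qed.

Definition prod_quandle : quandle :=
  Quandle prod_nonempty prod_idem prod_distr prod_ldiv.

End ProductQuandle.

Definition isomorphic (A B : quandle) : Prop :=
  exists2 f : A -> B,
    (forall x y : A, f (x |> y) = f x |> f y) & bijective f.

(* Main.v *)
From mathcomp Require Import all_boot.
From mathcomp Require Import boolp classical_sets.
Require Import Defs.

(** In a product of a latin quandle and a projection quandle, the left
    translation by a pair depends on its first component only, and determines
    it, whereas two pairs share an orbit exactly when their second components
    agree. So the first component must be recovered as the class of an element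
    under the relation of having the same left translation, and the theorem
    amounts to the claim that every such class meets every orbit in exactly one
    point.

    At most one point: if [a] and [b] lie in one orbit and translate alike, then
    [a |> a = b |> a], and right translations of a latin orbit are injective.

    At least one point ([orbit_meets_fixed_points] and
    [translation_eq_of_fixed]): in a medial quandle with latin orbits, having
    the same left translation turns out to be the same as the single equation
    [a |> b = b], and this equation is solvable for [b] in any prescribed orbit.

    Hence, for a fixed base point [e], sending [x] to the fixed point of its
    left translation in the orbit of [e], paired with the orbit of [x], is a
    bijection. It is a homomorphism because mediality makes fixed points
    multiply: if [x |> b = b] and [y |> c = c] then
    [(x |> y) |> (b |> c) = b |> c]. *)

Set Implicit Arguments.
Unset Strict Implicit.
Unset Printing Implicit Defensive.

Local Open Scope classical_set_scope.

Lemma LMlt_has_inverse (Q : quandle) (f : Q -> Q) :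
  LMlt f -> exists g, [/\ LMlt g, cancel f g & cancel g f].
Proof.
elim=> {f} [a||f1 f2 _ [g1 [L1 fK1 gK1]] _ [g2 [L2 fK2 gK2]]|f g Lf _ fK gK].
- have [g gP] := choice (q_ldiv a).
  have gK : cancel g (left_translation a) by move=> z; case: (gP z).
  have Kg : cancel (left_translation a) g.
    by move=> z; case: (gP (a |> z)) => _; exact.
  by exists g; split=> //; exact: LMlt_inv (LMlt_gen a) Kg gK.
- by exists id; split=> //; exact: LMlt_id.
- exists (g2 \o g1); split; [exact: LMlt_comp|exact: can_comp|exact: can_comp].
- by exists f.
Qed.

Lemma orbit_refl (Q : quandle) (x : Q) : orbit x x.
Proof. by exists id => //; exact: LMlt_id. Qed.

Lemma orbit_eq (Q : quandle) (x y : Q) : orbit x y -> orbit x = orbit y.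
Proof.
case=> f Lf <-; have [g [Lg fK _]] := LMlt_has_inverse Lf.
apply/seteqP; split=> _ [h Lh <-].
- by exists (h \o g); [exact: LMlt_comp | rewrite /= fK].
- by exists (h \o f); first exact: LMlt_comp.
Qed.

Lemma orbit_opr (Q : quandle) (o x y : Q) : orbit o y -> orbit o (x |> y).
Proof.
case=> f Lf <-; exists (left_translation x \o f) => //.
by apply: LMlt_comp => //; exact: LMlt_gen.
Qed.

Section LatinOrbits.
Variable Q : quandle.
Hypothesis orbits_latin : forall x : Q, latin (orbit_quandle x).

Lemma latin_orbit_inj (o a x y : Q) :
  orbit o a -> orbit o x -> orbit o y -> x |> a = y |> a -> x = y.
Proof.
move=> oa ox oy xy.
pose lift z (oz : orbit o z) : orbit_quandle o := SigSub (mem_set oz).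
have /bij_inj Ra_inj := orbits_latin (lift a oa).
have lift_xy : lift x ox = lift y oy by apply: Ra_inj; apply: val_inj.
exact: (congr1 (fun u : set_type (orbit o) => val u) lift_xy).
Qed.

Lemma latin_orbit_rdiv (o a c : Q) :
  orbit o a -> orbit o c -> exists2 b, orbit o b & b |> a = c.
Proof.
move=> oa oc.
pose lift z (oz : orbit o z) : orbit_quandle o := SigSub (mem_set oz).
have [g _ gK] := orbits_latin (lift a oa).
exists (val (g (lift c oc))); first exact: set_valP.
exact: (congr1 (fun u : set_type (orbit o) => val u) (gK (lift c oc))).
Qed.

Hypothesis Q_medial : medial Q.

(** Right division inside the orbit yields [b] with [b |> o = a |> o];
    mediality then gives [(a |> b) |> o = (a |> o) |> (b |> o) = b |> o], and
    cancelling [o] leaves [a |> b = b]. *)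
Lemma orbit_meets_fixed_points (a o : Q) : exists2 b, orbit o b & a |> b = b.
Proof.
have oo := orbit_refl o.
have [b ob boE] := latin_orbit_rdiv oo (orbit_opr a oo).
exists b => //; apply: (latin_orbit_inj oo (orbit_opr a ob) ob).
by rewrite -{1}(q_idem o) Q_medial -boE q_idem.
Qed.

(** Mediality gives [(a |> x) |> (b |> x) = (a |> b) |> x = b |> x], which is
    also [(b |> x) |> (b |> x)]; both left factors lie in the orbit of [x],
    where [b |> x] can be cancelled. *)
Lemma translation_eq_of_fixed (a b x : Q) : a |> b = b -> a |> x = b |> x.
Proof.
move=> ab; have ox z := orbit_opr z (orbit_refl x).
by apply: (latin_orbit_inj (ox b)) => //; rewrite Q_medial ab !q_idem.
Qed.

(** Being equivalent to equality of left translations, the relation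
    [a |> b = b] is an equivalence; this is what lets the fixed points of
    different elements be compared. *)
Lemma fixed_sym (a b : Q) : a |> b = b -> b |> a = a.
Proof. by move/translation_eq_of_fixed <-; exact: q_idem. Qed.

Lemma fixed_trans (a b c : Q) : a |> b = b -> b |> c = c -> a |> c = c.
Proof. by move/translation_eq_of_fixed ->. Qed.

Lemma orbit_fixed_eq (o a b : Q) :
  orbit o a -> orbit o b -> a |> b = b -> a = b.
Proof.
by move=> oa ob ab; apply: (latin_orbit_inj ob) => //; rewrite q_idem.
Qed.

End LatinOrbits.

Section ProjectionQuandle.
Variable T : Type.
Hypothesis T_inhabited : inhabited T.

Definition proj_op (_ y : T) : T := y.

Lemma proj_ldiv (x y : T) : exists! u, proj_op x u = y.
Proof. by exists y; split. Qed.

Definition projection_quandle : quandle :=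
  Quandle T_inhabited (fun=> erefl) (fun _ _ _ => erefl) proj_ldiv.

End ProjectionQuandle.

Theorem theorem5p5 (Q : quandle) (Q_medial : medial Q)
    (orbits_latin : forall x : Q, latin (orbit_quandle x)) :
  exists L P : quandle,
    latin L /\ projection P /\ isomorphic Q (prod_quandle L P).
Proof.
have [e] := q_nonempty Q.
pose L := orbit_quandle e.
pose orbits := set_type (range (@orbit Q)).
pose cls x : orbits := SigSub (mem_set (imageT (@orbit Q) x)).
pose P := projection_quandle (inhabits (cls e)).
exists L, P; split; first exact: orbits_latin.
split=> //.
have /choice[pi piP] (x : Q) : exists b : L, x |> val b = val b.
  have [b eb xb] := orbit_meets_fixed_points orbits_latin Q_medial x e.
  by exists (SigSub (mem_set eb)).
have pi_uniq x (b : L) : x |> val b = val b -> pi x = b.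
  move=> xb; apply: val_inj.
  apply: (orbit_fixed_eq orbits_latin (set_valP (pi x)) (set_valP b)).
  apply: (fixed_trans orbits_latin Q_medial _ xb).
  exact (fixed_sym orbits_latin Q_medial (piP x)).
pose f x : prod_quandle L P := (pi x, cls x).
exists f.
  move=> x y; congr pair.
    by apply: pi_uniq; rewrite /= Q_medial !piP.
  by apply: val_inj; rewrite /= -(orbit_eq (orbit_opr x (orbit_refl y))).
have f_inj : injective f.
  move=> x y fxy; have pixy : pi x = pi y := congr1 fst fxy.
  have clsxy : cls x = cls y := congr1 snd fxy.
  have oxy : orbit x = orbit y := congr1 val clsxy.
  apply: (orbit_fixed_eq orbits_latin (orbit_refl x)).
    by rewrite oxy; exact: orbit_refl.
  apply: (fixed_trans orbits_latin Q_medial (piP x)).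
  by rewrite pixy; exact (fixed_sym orbits_latin Q_medial (piP y)).
have /choice[g gK] (p : prod_quandle L P) : exists x, f x = p.
  case: p => b c; have [o _ oc] := set_valP c.
  have [x ox bx] := orbit_meets_fixed_points orbits_latin Q_medial (val b) o.
  exists x; congr pair.
    by apply: pi_uniq; exact: (fixed_sym orbits_latin Q_medial bx).
  by apply: val_inj; rewrite /= -(orbit_eq ox) oc.
by exists g => // x; apply: f_inj; rewrite gK.
Qed.
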